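(* Let $0 < \alpha < 1$. If $M_n \subseteq \mathbb{R}^p$ is a non-random Borel set that satisfies Condition A with matrix $\bar C = C_n$ and $$\min_{d \in \{-1,1\}^p} P(\hat u_n^d \in M_n) = 1-\alpha, \qquad \hat u_n^d \sim N(-n^{-1/2}C_n^{-1}\Lambda_n d,\ \sigma^2C_n^{-1}),$$ then $$\inf_{\beta \in \mathbb{R}^p} P_\beta(\beta \in \hat\beta_L - n^{-1/2}M_n) = 1-\alpha.$$
   Context: Model: $y = X\beta + \varepsilon$, where $X$ is a non-random real $n\times p$ matrix of full column rank $p$ (so $p \le n$), $\beta \in \mathbb{R}^p$ is the unknown parameter, and $\varepsilon \sim N(0,\sigma^2 I_n)$. $P_\beta$ denotes probability when the true parameter is $\beta$. Let $\lambda_{n,1},\dots,\lambda_{n,p} \ge 0$ be non-random tuning parameters and $\Lambda_n = \mathrm{diag}(\lambda_{n,1},\dots,\lambda_{n,p})$. The Lasso estimator $\hat\beta_L$ is the unique minimizer over $b \in \mathbb{R}^p$ of $\|y - Xb\|^2 + 2\sum_{j=1}^p \lambda_{n,j}|b_j|$. Put $C_n = X'X/n$. For a set $M$, a vector $a$ and a scalar $c$, $a - cM = \{a - cm : m \in M\}$. For $m \in \mathbb{R}^p$, $d \in \{-1,1\}^p$ and $\bar C \in \mathbb{R}^{p\times p}$ let $A^d_{\bar C}(m) = \bigcap_{j=1}^p\{z \in \mathbb{R}^p : d_j(\bar Cm)_j \le d_j(\bar Cz)_j,\ d_jz_j \le 0\}$. A set $M\subseteq \mathbb{R}^p$ satisfies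 Condition A with matrix $\bar C$ if $A^d_{\bar C}(m) \subseteq M$ for all $d \in \{-1,1\}^p$ and all $m \in M$. *)

(* Defs.v *)
From HB Require Import structures.
From mathcomp Require Import all_boot all_order all_algebra.
From mathcomp Require Import all_classical all_reals all_analysis.

Set Implicit Arguments.
Unset Strict Implicit.
Unset Printing Implicit Defensive.

Import Order.TTheory GRing.Theory Num.Theory.
Import numFieldNormedType.Exports.

Local Open Scope classical_set_scope.
Local Open Scope ring_scope.

(* R^k with its Borel sigma-algebra. *)
Definition borel_vec (R : realType) (k : nat) :=
  g_sigma_algebraType (@open 'cV[R]_k).

(* G is N(0, I_k): the coordinates are independent (product rule on all
   measurable rectangles) and each of them is N(0, 1). *)
Definition std_normal_vec (R : realType) (k : nat)
    (G : set (borel_vec R k) -> \bar R) : Prop :=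
  forall B : 'I_k -> set R, (forall i, measurable (B i)) ->
    G [set z : 'cV[R]_k | forall i, B i (z i 0)] =
    (\prod_(i < k) normal_prob 0 1 (B i))%E.

(* Q is N(mu, Sigma): Q is the law of mu + A Z for some Z ~ N(0, I_k) and some
   A with A A' = Sigma; this allows a singular Sigma. *)
Definition is_mvnormal (R : realType) (p : nat)
    (Q : set (borel_vec R p) -> \bar R)
    (mu : 'cV[R]_p) (Sigma : 'M[R]_p) : Prop :=
  exists (k : nat) (A : 'M[R]_(p, k)) (G : probability (borel_vec R k) R),
    [/\ std_normal_vec G, A *m A^T = Sigma &
        forall B : set (borel_vec R p), measurable B ->
          Q B = G [set z : 'cV[R]_k | B (mu + A *m z)]].

(* Squared Euclidean norm; the library norm `|v| on matrices is the max norm. *)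
Definition sqnorm (R : realType) (n : nat) (v : 'cV[R]_n) : R :=
  \sum_(i < n) v i 0 ^+ 2.

Definition lasso_objective (R : realType) (n p : nat) (X : 'M[R]_(n, p))
    (lambda : 'rV[R]_p) (y : 'cV[R]_n) (b : 'cV[R]_p) : R :=
  sqnorm (y - X *m b) + 2 * \sum_(j < p) lambda 0 j * `|b j 0|.

Definition is_lasso (R : realType) (n p : nat) (X : 'M[R]_(n, p))
    (lambda : 'rV[R]_p) (betaL : 'cV[R]_n -> 'cV[R]_p) : Prop :=
  forall y : 'cV[R]_n,
    [set b | forall b' : 'cV[R]_p,
       lasso_objective X lambda y b <= lasso_objective X lambda y b'] =
    [set betaL y].

Definition gram (R : realType) (n p : nat) (X : 'M[R]_(n, p)) : 'M[R]_p :=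
  n%:R^-1 *: (X^T *m X).

(* {-1, 1}^p is indexed by {ffun 'I_p -> bool}: false stands for 1 and true
   for -1. *)
Definition signs (p : nat) := {ffun 'I_p -> bool}.

Definition sign_vec (R : realType) (p : nat) (d : signs p) : 'cV[R]_p :=
  \col_j (-1) ^+ d j.

Definition setA_d (R : realType) (p : nat) (C : 'M[R]_p) (d : signs p)
    (m : 'cV[R]_p) : set 'cV[R]_p :=
  \bigcap_(j in [set: 'I_p])
    [set z : 'cV[R]_p |
      sign_vec R d j 0 * (C *m m) j 0 <= sign_vec R d j 0 * (C *m z) j 0 /\
      sign_vec R d j 0 * z j 0 <= 0].

Definition conditionA (R : realType) (p : nat) (C : 'M[R]_p)
    (M : set 'cV[R]_p) : Prop :=
  forall (d : signs p) (m : 'cV[R]_p), M m -> setA_d C d m `<=` M.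

Definition shift_set (R : realType) (p : nat) (a : 'cV[R]_p) (c : R)
    (M : set 'cV[R]_p) : set 'cV[R]_p :=
  [set a - c *: m | m in M].

(* Main.v *)
Require Import Defs.
From HB Require Import structures.
From mathcomp Require Import all_boot all_order all_algebra.
From mathcomp Require Import all_classical all_reals all_analysis.
From mathcomp Require Import measurable_realfun ring lra.

(** Write [u = sqrt n (betaL - beta)] for the scaled estimation error.  The event
    to be covered is [u \in M], and [u] is a function of the noise [e] and of
    [beta].  Replacing the penalty [|b_j|] by the linear function [d_j b_j] gives a
    Gaussian vector [u^d], also a function of the same [e]; its law is that of
    [uhat d].

    Lower bound. Fix [beta] and let [d] be its sign pattern. The optimality
    conditions of the Lasso ([lasso_minP]) compare [C u] with [C u^d], for the
    matrix [C = X'X / n], coordinate by coordinate: in the direction [d_j] the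
    former is never smaller, and the two agree as soon as [d_j u_j > 0], because
    then the estimate has sign [d_j]. Flipping the sign of [d] at these latter
    coordinates yields a sign pattern [d'], which depends on [e], with [u] in the
    set attached to [d'] and [u^d] by condition A. Hence [u^d \in M] implies [u \in
    M] for every [e], with a [d] that does not depend on [e] ([signed_error_sub]),
    and the coverage at [beta] is at least [P (u^d \in M)].

    Upper bound.  Fix [d] and let [beta] go to infinity along [d].  As soon as
    [beta + u^d / sqrt n] has the signs [d], the vector [u^d] satisfies the
    optimality conditions, so [u = u^d] ([scaled_error_eq]).  The exceptional
    events decrease to the empty set, so the infimum of the coverages is at most
    [P (u^d \in M)] ([coverage_far]).

    The two bounds speak of [u^d], built from the noise of the model, while the
    hypothesis speaks of [uhat d], which may live on another probability space and
    come from another factor of the covariance.  What has to be shown is that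
    [N(mu, Sigma)] is a single law ([is_mvnormal_unique]).  For a vector [a] let
    [T_a f (x)] be the mean of [f (x + t a)] for [t ~ N(0, 1)].  If [a_1, ..., a_k]
    are the columns of [A] and [Z] is standard normal, the mean of [f (mu + A Z)]
    is [T_(a_1) ... T_(a_k) f (mu)].  The standard normal law of the plane is
    invariant under rotations, so [T_a T_b] does not change when the pair [a, b] is
    rotated.  By such rotations any list of vectors is brought to an echelon form
    which, up to signs, is determined by the sum of the [a_i a_i^T]
    ([gauss_avgs_outer_sum]): this is the uniqueness of the Cholesky factor. *)

Set Implicit Arguments.
Unset Strict Implicit.
Unset Printing Implicit Defensive.

Import Order.TTheory GRing.Theory Num.Theory.
Import numFieldNormedType.Exports.

Local Open Scope classical_set_scope.
Local Open Scope ring_scope.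

(** * Rotations of the Gaussian plane *)

Section lebesgue_plane.
Context {R : realType}.
Local Notation T := (measurableTypeR R).
Implicit Types (f : T -> \bar R).
Local Notation mu := (@lebesgue_measure R).
Local Notation gauss := (normal_prob (0 : R) 1).
Local Notation phi := (normal_pdf (0 : R) 1).

Lemma lebesgue_measure_shift (c : R) (A : set R) : measurable A ->
  pushforward mu (fun x => x + c : T) A = mu A.
Proof.
move=> mA.
have mshift : measurable_fun setT (fun x : T => x + c : T).
  by apply: measurable_funD.
pose F : {mfun T >-> T} :=
  HB.pack (fun x : T => x + c : T)
    (isMeasurableFun.Build _ _ _ _ _ mshift).
apply/esym/(@lebesgue_measure_unique _ (pushforward mu F)) => //= _ [[a b]] _ <-.
rewrite /pushforward [F @^-1` _](_ : _ = `]a - c, b - c]%classic); last first.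
  by apply/seteqP; split=> x /=; rewrite !in_itv/= lerBrDr ltrBlDr.
rewrite !lebesgue_measure_itv/= !lte_fin -!EFinD ltrD2r opprD opprK addrACA.
by rewrite (addrC (- c)) subrr addr0.
Qed.


Lemma integral_lebesgue_shift (c : R) f : measurable_fun setT f ->
  (forall x, 0 <= f x)%E ->
  (\int[mu]_x f (x + c)%R = \int[mu]_x f x)%E.
Proof.
move=> mf f0.
have mshift : measurable_fun setT (fun x : T => x + c : T).
  by apply: measurable_funD.
rewrite [RHS](eq_measure_integral
  (pushforward mu (fun x : T => x + c : T))).
  by rewrite ge0_integral_pushforward.
by move=> A mA _ /=; exact/esym/lebesgue_measure_shift.
Qed.

Lemma integral_shear_fst (a : R) (g : T * T -> \bar R) :
  measurable_fun setT g -> (forall z, 0 <= g z)%E ->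
  (\int[mu]_x \int[mu]_y g (x + a * y, y)%R = \int[mu]_x \int[mu]_y g (x, y))%E.
Proof.
move=> mg g0.
have mS : measurable_fun setT (fun z : T * T => (z.1 + a * z.2, z.2)).
  apply: measurable_fun_pair => //=.
  by apply: measurable_funD => //; exact: measurable_funM.
pose h (z : T * T) := g (z.1 + a * z.2, z.2).
have mh : measurable_fun setT h := measurableT_comp mg mS.
have h0 z : (0 <= h z)%E by exact: g0.
have := @fubini_tonelli _ _ T T R mu mu h mh h0; rewrite /h/= => ->.
have -> := @fubini_tonelli _ _ T T R mu mu g mg g0.
apply: eq_integral => y _.
apply: (integral_lebesgue_shift (a * y) (f := fun x => g (x, y))) => //.
exact: measurableT_comp.
Qed.

Lemma integral_shear_snd (a : R) (g : T * T -> \bar R) :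
  measurable_fun setT g -> (forall z, 0 <= g z)%E ->
  (\int[mu]_x \int[mu]_y g (x, y + a * x)%R = \int[mu]_x \int[mu]_y g (x, y))%E.
Proof.
move=> mg g0; apply: eq_integral => x _.
rewrite (integral_lebesgue_shift (a * x) (f := fun y => g (x, y)))//.
exact: measurableT_comp.
Qed.

(** A rotation is a product of three shears, and a shear acts by a translation on
    each line parallel to its axis. *)
Lemma integral_lebesgue_rotation (c s : R) (g : T * T -> \bar R) :
  c ^+ 2 + s ^+ 2 = 1 -> c != -1 ->
  measurable_fun setT g -> (forall z, 0 <= g z)%E ->
  (\int[mu]_x \int[mu]_y g (c * x - s * y, s * x + c * y)%R =
   \int[mu]_x \int[mu]_y g (x, y))%E.
Proof.
move=> cs cN1 mg g0.
(* t is the tangent of half the angle *)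
pose t := s / (1 + c).
have c1 : 1 + c != 0 by rewrite addrC addr_eq0.
have st : s * t = 1 - c.
  rewrite /t mulrA -expr2; apply: (mulIf c1); rewrite divfK//.
  by rewrite -(addKr (c ^+ 2) (s ^+ 2)) cs; ring.
have tc : t * (1 + c) = s by rewrite divfK.
have m1 : measurable_fun setT (fun z : T * T => (z.1 + (- t) * z.2, z.2)).
  apply: measurable_fun_pair => //=.
  by apply: measurable_funD => //; exact: measurable_funM.
have m2 : measurable_fun setT (fun z : T * T => (z.1, z.2 + s * z.1)).
  apply: measurable_fun_pair => //=.
  by apply: measurable_funD => //; exact: measurable_funM.
pose g1 (z : T * T) := g (z.1 + (- t) * z.2, z.2).
pose g2 (z : T * T) := g1 (z.1, z.2 + s * z.1).
have mg1 : measurable_fun setT g1 by exact: (measurableT_comp mg m1).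
have mg2 : measurable_fun setT g2 by exact: (measurableT_comp mg1 m2).
rewrite -[RHS](integral_shear_fst (- t) mg g0).
rewrite -[RHS](integral_shear_snd s mg1 (fun=> g0 _)).
rewrite -[RHS](integral_shear_fst (- t) mg2 (fun=> g0 _)).
apply: eq_integral => x _; apply: eq_integral => y _; rewrite /g2 /g1 /=.
have -> : y + s * (x + - t * y) = s * x + c * y.
  by rewrite mulrDr mulrA mulrN st; ring.
congr (g (_, _)); rewrite mulrDr !mulNr !mulrA [t * s]mulrC st -[in LHS]tc.
ring.
Qed.

(** [normal_prob] is given by its density on sets only; the Radon-Nikodym
    derivative, which equals that density almost everywhere, carries the formula to
    functions. *)
Lemma integral_normal_prob_density f : measurable_fun setT f ->
  (forall x, 0 <= f x)%E ->
  (\int[gauss]_x f x = \int[mu]_x (f x * (phi x)%:E))%E.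
Proof.
move=> mf f0.
have dom : gauss `<< mu by exact: normal_prob_dominates.
rewrite -(Radon_Nikodym_SigmaFinite.change_of_variables dom)//.
have mphi : measurable_fun setT (fun x => (phi x)%:E).
  by apply/measurable_EFinP; exact: measurable_normal_pdf.
have iRN := Radon_Nikodym_SigmaFinite.f_integrable dom.
apply: ae_eq_integral => //.
- by apply: emeasurable_funM => //; exact: measurable_int iRN.
- exact: emeasurable_funM.
- apply: ae_eqe_mul2l; apply: integral_ae_eq => //.
  by move=> E _ mE; rewrite -Radon_Nikodym_SigmaFinite.f_integral.
Qed.

Lemma normal_pdf_rotation (c s x y : R) : c ^+ 2 + s ^+ 2 = 1 ->
  phi (c * x - s * y) * phi (s * x + c * y) = phi x * phi y.
Proof.
move=> cs; rewrite !normal_pdfE ?oner_neq0// /normal_fun !subr0 expr1n.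
rewrite mulrACA [RHS]mulrACA -!expRD; congr (_ * expR _).
rewrite -!mulrDl; congr (_ / _); rewrite -[RHS]mulr1 -cs; ring.
Qed.

(** Both the Lebesgue measure and the density [phi x * phi y], a function of
    [x ^+ 2 + y ^+ 2], are invariant. *)
Lemma integral_gauss_rotation (c s : R) (g : T * T -> \bar R) :
  c ^+ 2 + s ^+ 2 = 1 -> c != -1 ->
  measurable_fun setT g -> (forall z, 0 <= g z)%E ->
  (\int[gauss]_x \int[gauss]_y g (c * x - s * y, s * x + c * y)%R =
   \int[gauss]_x \int[gauss]_y g (x, y))%E.
Proof.
move=> cs cN1 mg g0.
have dens (h : T * T -> \bar R) : measurable_fun setT h -> (forall z, 0 <= h z)%E ->
  (\int[gauss]_x \int[gauss]_y h (x, y) =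
   \int[mu]_x \int[mu]_y (h (x, y) * (phi x * phi y)%:E))%E.
  move=> mh h0; rewrite integral_normal_prob_density//; last 2 first.
  - exact: (measurable_fun_fubini_tonelli_F (m2 := gauss) h).
  - by move=> x; exact: integral_ge0.
  apply: eq_integral => x _.
  have mhx : measurable_fun setT (fun y => h (x, y)) by exact: measurableT_comp.
  rewrite integral_normal_prob_density// -ge0_integralZr//.
  - by apply: eq_integral => y _; rewrite -muleA -EFinM [phi y * _]mulrC.
  - apply: emeasurable_funM => //.
    by apply/measurable_EFinP; exact: measurable_normal_pdf.
  - by move=> y _; rewrite mule_ge0// lee_fin normal_pdf_ge0.
  - by rewrite lee_fin normal_pdf_ge0.
have mphi2 : measurable_fun setT (fun z : T * T => (phi z.1 * phi z.2)%:E).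
  apply/measurable_EFinP; apply: measurable_funM.
  - exact: (measurableT_comp (measurable_normal_pdf _ _)).
  - exact: (measurableT_comp (measurable_normal_pdf _ _)).
have mrot : measurable_fun setT
    (fun z : T * T => (c * z.1 - s * z.2, s * z.1 + c * z.2)).
  apply: measurable_fun_pair => /=.
    by apply: measurable_funB; exact: measurable_funM.
  by apply: measurable_funD; exact: measurable_funM.
pose g' (z : T * T) := g (c * z.1 - s * z.2, s * z.1 + c * z.2).
have mg' : measurable_fun setT g' := measurableT_comp mg mrot.
pose h (z : T * T) := (g z * (phi z.1 * phi z.2)%:E)%E.
have mh : measurable_fun setT h by exact: emeasurable_funM.
have h0 z : (0 <= h z)%E.
  by rewrite /h mule_ge0// lee_fin mulr_ge0// normal_pdf_ge0.
have := dens g' mg' (fun=> g0 _); rewrite /g'/= => ->.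
rewrite (dens g mg g0).
have := integral_lebesgue_rotation cs cN1 mh h0; rewrite /h/= => <-.
by apply: eq_integral => x _; apply: eq_integral => y _; rewrite normal_pdf_rotation.
Qed.

End lebesgue_plane.

(** * Borel sets of vectors *)

Section borel_vectors.
Context {R : realType}.

Lemma continuous_measurable_vec p (f : 'cV[R]_p -> R) : continuous f ->
  measurable_fun setT (f : borel_vec R p -> R).
Proof.
move=> cf; apply: (measurability _ (RGenOInfty.measurableE R)) => _ [_ [r ->] <-].
rewrite setTI; apply: sub_sigma_algebra.
by apply: open_comp; [move=> x _; exact: cf|exact: interval_open].
Qed.

Lemma measurable_coord p (i : 'I_p) :
  measurable_fun setT (fun x : borel_vec R p => (x : 'cV[R]_p) i 0).
Proof. by apply: continuous_measurable_vec => x; exact: coord_continuous. Qed.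

(** Rational boxes form a countable base of open sets.  This makes the Borel sets
    of ['cV_p] generated by the coordinates, although they are defined from the
    topology of the norm. *)
Lemma open_boxE p (U : set 'cV[R]_p) : open U ->
  U = \bigcup_(c in [set c : 'cV[rat]_p * nat |
        forall x : 'cV[R]_p,
          (forall i, ball (ratr (c.1 i 0) : R) c.2.+1%:R^-1 (x i 0)) -> U x])
      [set x | forall i, ball (ratr (c.1 i 0) : R) c.2.+1%:R^-1 (x i 0)].
Proof.
move=> oU; apply/seteqP; split=> [x Ux|x [c cU /= /cU//]].
have /nbhs_ballP[e /= e0 eU] := open_nbhs_nbhs (conj oU Ux).
have [n] : exists n, n.+1%:R^-1 < e / 2.
  have /ltr_add_invr[n] : 0 < e / 2 by rewrite divr_gt0.
  by rewrite add0r; exists n.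
have : 0 < n.+1%:R^-1 :> R by rewrite invr_gt0.
set r := n.+1%:R^-1 => r0 re.
have q_ i : {q : rat | ball (ratr q : R) r (x i 0)}.
  apply: cid; have /rat_in_itvoo[q] : x i 0 - r < x i 0 + r by lra.
  rewrite in_itv/= => /andP[q1 q2]; exists q.
  rewrite /ball/= ltr_distlC; apply/andP; split; lra.
exists (\col_i sval (q_ i), n) => /=; rewrite -/r; last first.
  by move=> i; rewrite mxE; case: (q_ i).
move=> y Hy; apply: eU; split=> // i j; rewrite (ord1 j).
have := Hy i; rewrite mxE; case: (q_ i) => q /= xq yq.
apply: (le_ball (e1 := r + r)); first by lra.
exact: ball_triangle (ball_sym xq) yq.
Qed.

Lemma measurable_borel_vec d (T : measurableType d) p (f : T -> borel_vec R p) :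
  (forall i, measurable_fun setT (fun t => (f t : 'cV[R]_p) i 0)) ->
  measurable_fun setT f.
Proof.
have borelE : @measurable _ (borel_vec R p) = <<s @open 'cV[R]_p >> by [].
move=> mf; apply: (measurability _ borelE) => _ [U oU <-].
rewrite setTI (open_boxE oU) preimage_bigcup.
have mbox (c : 'cV[rat]_p * nat) : measurable
    (f @^-1` [set x | forall i, ball (ratr (c.1 i 0) : R) c.2.+1%:R^-1 (x i 0)]).
  rewrite (_ : _ @^-1` _ = \bigcap_(i in setT)
     ((fun t => (f t : 'cV[R]_p) i 0) @^-1` ball (ratr (c.1 i 0) : R) c.2.+1%:R^-1)).
    apply: fin_bigcap_measurable => // i _.
    rewrite -[X in measurable X]setTI; apply: mf => //.
    exact: measurable_ball.
  by apply/seteqP; split=> t /= h i => [_|]; exact: h.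
rewrite bigcup_mkcond; apply: countable_bigcupT_measurable => // c.
by case: ifP.
Qed.

End borel_vectors.

(** * Gaussian averages along vectors *)

Section gauss_avg.
Context {R : realType} {p : nat}.
Local Notation gauss := (normal_prob (0 : R) 1).
Local Notation V := 'cV[R]_p.
Implicit Types (f : borel_vec R p -> \bar R) (a b x : V) (s : seq V).

Definition nneg_mfun f := measurable_fun setT f /\ forall x, (0 <= f x)%E.

Definition gauss_avg a f : borel_vec R p -> \bar R :=
  fun x => (\int[gauss]_t f ((x : V) + t *: a : V)%R)%E.

Definition gauss_avgs s f := foldr gauss_avg f s.

Lemma measurable_ray a : measurable_fun setT
  (fun z : borel_vec R p * measurableTypeR R => (z.1 : V) + z.2 *: a : borel_vec R p).
Proof.
apply: measurable_borel_vec => i.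
rewrite (_ : (fun _ => _) = (fun z : borel_vec R p * measurableTypeR R =>
    (z.1 : V) i 0 + z.2 * a i 0)); last by apply/funext => z; rewrite !mxE.
apply: measurable_funD.
  exact: (measurableT_comp (measurable_coord i) measurable_fst).
by apply: measurable_funM => //; exact: measurable_snd.
Qed.

Lemma measurable_plane x a b : measurable_fun setT
  (fun z : measurableTypeR R * measurableTypeR R =>
     x + z.1 *: a + z.2 *: b : borel_vec R p).
Proof.
apply: measurable_borel_vec => i.
rewrite (_ : (fun _ => _) = (fun z : measurableTypeR R * measurableTypeR R =>
    x i 0 + z.1 * a i 0 + z.2 * b i 0)); last by apply/funext => z; rewrite !mxE.
apply: measurable_funD; last by apply: measurable_funM.
by apply: measurable_funD => //; apply: measurable_funM.
Qed.

Lemma nneg_mfun_line f a x : nneg_mfun f ->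
  measurable_fun setT (fun t : measurableTypeR R => f (x + t *: a : V)).
Proof.
move=> [mf _]; apply: (measurableT_comp mf).
apply: measurable_borel_vec => i.
rewrite (_ : (fun _ => _) = (fun t : measurableTypeR R =>
    x i 0 + t * a i 0)); last by apply/funext => z; rewrite !mxE.
by apply: measurable_funD => //; apply: measurable_funM.
Qed.

Lemma gauss_avg_nneg_mfun a f : nneg_mfun f -> nneg_mfun (gauss_avg a f).
Proof.
move=> [mf f0]; split; last by move=> x; exact: integral_ge0.
exact: (measurable_fun_fubini_tonelli_F (m2 := gauss) _
  (measurableT_comp mf (measurable_ray a)) (fun=> f0 _)).
Qed.

Lemma gauss_avgs_nneg_mfun s f : nneg_mfun f -> nneg_mfun (gauss_avgs s f).
Proof. by move=> nf; elim: s => //= a s; exact: gauss_avg_nneg_mfun. Qed.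

Lemma gauss_avg0 f : gauss_avg 0 f = f.
Proof.
apply/funext => x; rewrite /gauss_avg.
under eq_integral do rewrite scaler0 addr0.
by rewrite integral_cst// [X in (_ * X)%E]probability_setT mule1.
Qed.

(** Up to the base point, a double average along [a] and [b] is an integral over
    the Gaussian plane, and the new pair of vectors is the old one read in rotated
    coordinates. *)
Lemma gauss_avg_rotation (c s : R) a b f : c ^+ 2 + s ^+ 2 = 1 -> c != -1 ->
  nneg_mfun f ->
  gauss_avg a (gauss_avg b f) =
  gauss_avg (c *: a + s *: b) (gauss_avg (c *: b - s *: a) f).
Proof.
move=> cs cN1 [mf f0]; apply/funext => x; rewrite /gauss_avg.
pose g (z : measurableTypeR R * measurableTypeR R) := f (x + z.1 *: a + z.2 *: b : V).
have mg : measurable_fun setT g := measurableT_comp mf (measurable_plane x a b).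
have := integral_gauss_rotation cs cN1 mg (fun=> f0 _); rewrite /g/= => <-.
apply: eq_integral => t _; apply: eq_integral => u _; congr (f _).
apply/matrixP => i j; rewrite !mxE; ring.
Qed.

Lemma gauss_avgN a f : nneg_mfun f -> gauss_avg (- a) f = gauss_avg a f.
Proof.
(* a quarter turn sends the pair (a, 0) to (0, - a) *)
move=> nf; rewrite -[in RHS](gauss_avg0 f) (@gauss_avg_rotation 0 1) //.
- by rewrite !scale0r !scaler0 addr0 scale1r add0r gauss_avg0.
- by rewrite expr0n expr1n add0r.
- by rewrite eq_sym oppr_eq0 oner_neq0.
Qed.

(** The covariance of [\sum_i t_i *: a_i] for independent standard normal
    [t_i]. *)
Definition outer_sum s : 'M[R]_p := \sum_(a <- s) a *m a^T.

(** One step of elimination: each vector in turn is rotated against the current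
    pivot [b] so as to kill its coordinate [i].  Rotations keep both the average
    and the covariance, and keep the coordinates that vanish on the whole list,
    such as those eliminated before. *)
Lemma gauss_avgs_pivot (i : 'I_p) s : exists b s',
  [/\ forall f, nneg_mfun f -> gauss_avgs s f = gauss_avgs (b :: s') f,
      outer_sum s = outer_sum (b :: s'),
      (forall c, c \in s' -> c i 0 = 0) &
      forall j : 'I_p, (forall a, a \in s -> a j 0 = 0) ->
        forall a, a \in b :: s' -> a j 0 = 0].
Proof.
elim: s => [|a s [b [s' [avgE sumE s'i s'j]]]].
  exists 0, [::]; split=> //=.
  - by move=> f _; rewrite gauss_avg0.
  - by rewrite /outer_sum !big_cons !big_nil mul0mx addr0.
  - by move=> j _ c; rewrite inE => /eqP->; rewrite mxE.
have avg'E f : nneg_mfun f ->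
    gauss_avgs (a :: s) f = gauss_avg a (gauss_avg b (gauss_avgs s' f)).
  by move=> nf /=; rewrite avgE.
have sum'E : outer_sum (a :: s) = a *m a^T + (b *m b^T + outer_sum s').
  by rewrite /outer_sum big_cons -/(outer_sum s) sumE /outer_sum big_cons.
have zero j : (forall c, c \in a :: s -> c j 0 = 0) ->
    [/\ a j 0 = 0, b j 0 = 0 & forall c, c \in s' -> c j 0 = 0].
  move=> h; have hs c : c \in s -> c j 0 = 0.
    by move=> cs; apply: h; rewrite inE cs orbT.
  split; first by apply: h; rewrite inE eqxx.
  - by apply: (s'j j hs); rewrite inE eqxx.
  - by move=> c cs; apply: (s'j j hs); rewrite inE cs orbT.
have [bi0|bi0] := eqVneq (b i 0) 0.
  exists a, (b :: s'); split => //.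
  - by rewrite sum'E /outer_sum !big_cons.
  - by move=> c; rewrite inE => /predU1P[->|/s'i].
  - move=> j /zero[aj bj s'j0] c; rewrite !inE => /or3P[/eqP->|/eqP->|/s'j0]//.
pose r := Num.sqrt (a i 0 ^+ 2 + b i 0 ^+ 2).
have r2 : r ^+ 2 = a i 0 ^+ 2 + b i 0 ^+ 2.
  by rewrite sqr_sqrtr// addr_ge0// sqr_ge0.
have r0 : r != 0.
  apply: contra_neq bi0 => r0; move: r2; rewrite r0 expr0n => /esym/eqP.
  by rewrite paddr_eq0 ?sqr_ge0// !sqrf_eq0 => /andP[_ /eqP].
pose c := a i 0 / r; pose t := b i 0 / r.
have ct : c ^+ 2 + t ^+ 2 = 1.
  by rewrite !expr_div_n -mulrDl -r2 divff// sqrf_eq0.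
have t0 : t != 0 by rewrite mulf_neq0// invr_eq0.
have cN1 : c != -1.
  apply: contra_neq t0 => c1; apply/eqP; rewrite -sqrf_eq0.
  by move: ct; rewrite c1 sqrrN expr1n => /eqP; rewrite -subr_eq0 addrC addKr.
exists (c *: a + t *: b), (c *: b - t *: a :: s'); split.
- move=> f nf; rewrite (avg'E f nf).
  exact: (gauss_avg_rotation _ _ ct cN1 (gauss_avgs_nneg_mfun s' nf)).
- rewrite sum'E /outer_sum !big_cons addrA [RHS]addrA; congr (_ + _).
  apply/matrixP => k l; rewrite !mxE !big_ord1 !mxE.
  rewrite -[LHS]mulr1 -ct; ring.
- move=> d; rewrite inE => /predU1P[->|/s'i]//.
  by rewrite !mxE /c /t; field.
- move=> j /zero[aj bj s'j0] d; rewrite !inE => /or3P[/eqP->|/eqP->|/s'j0]//.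
  + by rewrite !mxE aj bj !mulr0 addr0.
  + by rewrite !mxE aj bj !mulr0 subr0.
Qed.

Lemma outer_sum_pivot (i j : 'I_p) b s : (forall c, c \in s -> c i 0 = 0) ->
  outer_sum (b :: s) i j = b i 0 * b j 0.
Proof.
move=> si; rewrite /outer_sum big_cons mxE mxE big_ord1 mxE summxE big_seq.
rewrite big1 ?addr0// => c cs; rewrite mxE big_ord1 si//; exact: mul0r.
Qed.

(** Eliminate the coordinates one by one in both lists.  After the elimination of
    coordinate [i], row [i] of the covariance is [b i 0 *: b^T] for the pivot [b]:
    if [b i 0] is not zero, the two pivots agree up to sign and can be removed;
    otherwise coordinate [i] vanishes in both lists. *)
Lemma gauss_avgs_outer_sum s1 s2 f : nneg_mfun f ->
  outer_sum s1 = outer_sum s2 -> gauss_avgs s1 f = gauss_avgs s2 f.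
Proof.
move=> nf sE.
(* k coordinates have been eliminated, at most m remain *)
suff IH (m k : nat) : (p <= m + k)%N -> forall s1 s2,
    (forall a, a \in s1 -> forall j : 'I_p, (j < k)%N -> a j 0 = 0) ->
    (forall a, a \in s2 -> forall j : 'I_p, (j < k)%N -> a j 0 = 0) ->
    outer_sum s1 = outer_sum s2 -> gauss_avgs s1 f = gauss_avgs s2 f.
  by apply: (IH p 0%N) => //; rewrite addn0.
elim: m k {s1 s2 sE} => [|m IH] k pk s1 s2 h1 h2 sE.
  have all0 (s : seq V) : (forall a, a \in s -> forall j : 'I_p, (j < k)%N -> a j 0 = 0) ->
      gauss_avgs s f = f.
    elim: s => //= a s IHs h; rewrite IHs; last first.
      by move=> c cs; apply: h; rewrite inE cs orbT.
    suff -> : a = 0 by rewrite gauss_avg0.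
    apply/matrixP => i j; rewrite (ord1 j) mxE; apply: h; first by rewrite inE eqxx.
    exact: leq_trans (ltn_ord i) pk.
  by rewrite !all0.
have [kp|pk'] := ltnP k p; last first.
  by apply: (IH k) => //; rewrite (leq_trans pk')// leq_addl.
pose i := Ordinal kp.
have [b1 [t1 [avg1 sum1 z1 p1]]] := gauss_avgs_pivot i s1.
have [b2 [t2 [avg2 sum2 z2 p2]]] := gauss_avgs_pivot i s2.
rewrite avg1// avg2//.
have gE j : b1 i 0 * b1 j 0 = b2 i 0 * b2 j 0.
  by rewrite -(outer_sum_pivot j b1 z1) -(outer_sum_pivot j b2 z2) -sum1 -sum2 sE.
have q1 a : a \in b1 :: t1 -> forall j : 'I_p, (j < k)%N -> a j 0 = 0.
  by move=> at1 j jk; apply: (p1 j) => // c cs; exact: (h1 c).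
have q2 a : a \in b2 :: t2 -> forall j : 'I_p, (j < k)%N -> a j 0 = 0.
  by move=> at2 j jk; apply: (p2 j) => // c cs; exact: (h2 c).
have ext (b : V) (t : seq V) :
    (forall a, a \in b :: t -> forall j : 'I_p, (j < k)%N -> a j 0 = 0) ->
    (forall c, c \in t -> c i 0 = 0) -> b i 0 = 0 ->
    forall a, a \in b :: t -> forall j : 'I_p, (j < k.+1)%N -> a j 0 = 0.
  move=> q z bi a abt j; rewrite ltnS leq_eqVlt => /predU1P[jk|]; last exact: q.
  have -> : j = i by apply/val_inj.
  by move: abt; rewrite inE => /predU1P[->|/z].
have [b10|b10] := eqVneq (b1 i 0) 0.
  have b20 : b2 i 0 = 0.
    have := gE i; rewrite b10 mul0r => /esym/eqP.
    by rewrite mulf_eq0 orbb => /eqP.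
  apply: (IH k.+1); rewrite ?addnS//.
  - exact: ext.
  - exact: ext.
  - by rewrite -sum1 -sum2.
have bb : b2 = b1 \/ b2 = - b1.
  have /eqP := gE i; rewrite -!expr2 eqf_sqr => /orP[/eqP e|/eqP e]; [left|right].
    apply/matrixP => j l; rewrite (ord1 l); apply: (mulfI b10).
    by rewrite gE -e.
  apply/matrixP => j l; rewrite (ord1 l) mxE; apply: (mulfI b10).
  by rewrite mulrN gE e mulNr.
have tE : outer_sum t1 = outer_sum t2.
  have := sE; rewrite sum1 sum2 /outer_sum !big_cons.
  have -> : b2 *m b2^T = b1 *m b1^T; last exact: addrI.
  by case: bb => ->//; apply/matrixP => k1 k2; rewrite !mxE !big_ord1 !mxE mulrNN.
have mono (t : seq V) : (forall a, a \in t -> forall j : 'I_p, (j < k)%N -> a j 0 = 0) ->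
    (forall c, c \in t -> c i 0 = 0) ->
    forall a, a \in t -> forall j : 'I_p, (j < k.+1)%N -> a j 0 = 0.
  move=> q z a ta j; rewrite ltnS leq_eqVlt => /predU1P[jk|]; last exact: q.
  by have -> : j = i by [exact/val_inj]; exact: z.
have tavg : gauss_avgs t1 f = gauss_avgs t2 f.
  apply: (IH k.+1); rewrite ?addnS//; apply: mono => // a ta.
    by apply: q1; rewrite inE ta orbT.
  by apply: q2; rewrite inE ta orbT.
rewrite /= tavg; case: bb => -> //.
by rewrite gauss_avgN//; exact: gauss_avgs_nneg_mfun.
Qed.

End gauss_avg.

(** * Uniqueness of the multivariate normal law *)

Section gauss_law.
Context {R : realType} {p : nat}.
Local Notation gauss := (normal_prob (0 : R) 1).
Local Notation V := 'cV[R]_p.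
Implicit Types (f : borel_vec R p -> \bar R) (a b x : V) (s : seq V)
  (D : set (borel_vec R p)).

Lemma gauss_avgs_nneseries s (f_ : nat -> borel_vec R p -> \bar R) x :
  (forall n, nneg_mfun (f_ n)) ->
  gauss_avgs s (fun z => \sum_(n <oo) f_ n z)%E x =
  (\sum_(n <oo) gauss_avgs s (f_ n) x)%E.
Proof.
move=> nf; elim: s x => //= a s IH x; rewrite /gauss_avg.
under eq_integral do rewrite IH.
rewrite integral_nneseries// => n.
- exact: (nneg_mfun_line a x (gauss_avgs_nneg_mfun s (nf n))).
- by move=> t _; case: (gauss_avgs_nneg_mfun s (nf n)).
Qed.

(** The law of [x + \sum_i t_i *: a_i], for [s] the list of the [a_i] and
    independent standard normal [t_i]. *)
Definition gauss_law s x D : \bar R := gauss_avgs s (fun z => (\1_D z)%:E) x.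

Lemma indic_nneg_mfun D : measurable D -> nneg_mfun (fun z => (\1_D z)%:E : \bar R).
Proof.
move=> mD; split; last by move=> x; rewrite lee_fin.
by apply/measurable_EFinP; exact: measurable_indic.
Qed.

Let gauss_law0 s x : gauss_law s x set0 = 0%E.
Proof.
rewrite /gauss_law indic0; elim: s x => //= a s IH x.
by rewrite /gauss_avg; under eq_integral do rewrite IH; rewrite integral0.
Qed.

Let gauss_law_ge0 s x D : (0 <= gauss_law s x D)%E.
Proof.
rewrite /gauss_law; elim: s x => [|a s IH] x; first by rewrite lee_fin.
by rewrite /= /gauss_avg; apply: integral_ge0 => t _; exact: IH.
Qed.

Let gauss_law_sigma_additive s x : semi_sigma_additive (gauss_law s x).
Proof.
move=> F mF tF mUF.
rewrite [X in _ --> X](_ : _ = \sum_(n <oo) gauss_law s x (F n))%E.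
  by apply: is_cvg_ereal_nneg_natsum_cond => n _ _; exact: gauss_law_ge0.
rewrite /gauss_law -gauss_avgs_nneseries; last by move=> n; exact: indic_nneg_mfun.
by congr (gauss_avgs s _ x); apply/funext => z; rewrite indic_bigcup.
Qed.

HB.instance Definition _ s x := isMeasure.Build _ _ _ (gauss_law s x)
  (gauss_law0 s x) (gauss_law_ge0 s x) (@gauss_law_sigma_additive s x).

End gauss_law.

Section std_normal.
Context {R : realType} {k : nat}.
Local Notation gauss := (normal_prob (0 : R) 1).
Local Notation V := 'cV[R]_k.

Definition box (B : 'I_k -> set R) : set (borel_vec R k) :=
  [set z : V | forall i, B i (z i 0)].

Definition boxes : set (set (borel_vec R k)) :=
  [set box B | B in [set B | forall i, measurable (B i)]].

Lemma boxes_setI_closed : setI_closed boxes.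
Proof.
move=> _ _ [A mA <-] [B mB <-]; exists (fun i => A i `&` B i).
  by move=> i; exact: measurableI.
apply/seteqP; split=> z /=; first by move=> h; split=> i; case: (h i).
by move=> [h1 h2] i; split.
Qed.

Lemma measurable_boxesE : @measurable _ (borel_vec R k) = <<s boxes >>.
Proof.
apply/seteqP; split.
  have mid : measurable_fun setT (id : g_sigma_algebraType boxes -> borel_vec R k).
    apply: measurable_borel_vec => i _ B mB; rewrite setTI.
    apply: sub_sigma_algebra; exists (fun j => if j == i then B else setT).
      by move=> j; case: ifP.
    apply/seteqP; split=> z /=; first by move/(_ i); rewrite eqxx.
    by move=> Bz j; case: eqP => // ->.
  by move=> A mA; have := mid measurableT A mA; rewrite setTI.
apply: smallest_sub; first exact: sigma_algebra_measurable.
move=> _ [B mB <-].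
rewrite (_ : box B = \bigcap_(i in setT) ((fun z : borel_vec R k => (z : V) i 0) @^-1` B i)).
  apply: fin_bigcap_measurable => // i _; rewrite -[X in measurable X]setTI.
  exact: measurable_coord.
by apply/seteqP; split=> z /= h i => [_|]; exact: h.
Qed.

Definition basis_vecs : seq V := [seq delta_mx i 0 | i <- enum 'I_k].

(** Averaging along the basis vector of index [i] only integrates the factor of
    index [i]. *)
Lemma gauss_avgs_box (B : 'I_k -> set R) (s : seq 'I_k) (x : V) :
  (forall i, measurable (B i)) -> uniq s -> (forall i, i \in s -> x i 0 = 0) ->
  gauss_avgs [seq delta_mx i 0 | i <- s] (fun z => (\1_(box B) z)%:E) x =
  (\prod_(i < k) (if i \in s then gauss (B i) else (\1_(B i) (x i 0))%:E))%E.
Proof.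
move=> mB; elim: s x => [|i s IH] x /=.
  move=> _ _; rewrite indicE; have [xB|xB] := boolP (x \in box B).
    move/set_mem : xB => xB; rewrite big1// => i _; rewrite indicE mem_set//.
  move: xB; rewrite notin_setE => /existsNP[i xBi].
  by rewrite (bigD1 i)//= indicE memNset// mul0e.
move=> /andP[iNs us] x0; rewrite /gauss_avg.
rewrite (bigD1 i)//= inE eqxx/=.
pose K := (\prod_(j < k | j != i)
  (if j \in s then gauss (B j) else (\1_(B j) (x j 0))%:E))%E.
transitivity (\int[gauss]_t ((\1_(B i) t)%:E * K))%E.
  apply: eq_integral => t _; rewrite IH//; last first.
    move=> j js; rewrite !mxE x0 ?inE ?js ?orbT// add0r.
    by have -> : (j == i) = false; rewrite ?andbF ?mulr0//; apply: contraNF iNs => /eqP<-.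
  rewrite (bigD1 i)//= (negbTE iNs); congr (_ * _)%E.
    by rewrite !mxE x0 ?inE ?eqxx// add0r mulr1.
  apply: eq_bigr => j ji; case: ifP => // _.
  by rewrite !mxE (negbTE ji) mulr0 addr0.
have K0 : (0 <= K)%E.
  by apply: prode_ge0 => j _; case: (j \in s); [exact: measure_ge0|rewrite lee_fin].
rewrite ge0_integralZr//.
- congr (_ * _)%E.
    by rewrite integral_indic ?setIT//; exact: mB.
  by apply: eq_bigr => j ji; rewrite inE (negbTE ji).
- by apply/measurable_EFinP; apply: measurable_indic; exact: mB.
Qed.

(** Measurable boxes form a pi-system that generates the Borel sets, so the product
    rule determines a standard normal law. *)
Lemma std_normal_vecE (G : probability (borel_vec R k) R) :
  std_normal_vec G -> forall D, measurable D -> G D = gauss_law basis_vecs 0 D.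
Proof.
move=> hG D mD.
apply: (measure_unique boxes (fun=> setT) measurable_boxesE boxes_setI_closed) => //.
- move=> _; exists (fun=> setT) => //.
  by apply/seteqP; split.
- by rewrite bigcup_const.
- move=> _ [B mB <-]; rewrite [LHS](hG B mB); apply/esym; rewrite [LHS]gauss_avgs_box//.
  + by apply: eq_bigr => i _; rewrite mem_enum.
  + exact: enum_uniq.
  + by move=> i _; rewrite mxE.
- by move=> _ /=; rewrite probability_setT ltry.
Qed.

End std_normal.

Lemma gauss_avgs_affine {R : realType} {k p : nat} (A : 'M[R]_(p, k)) (mu : 'cV_p)
    (f : borel_vec R p -> \bar R) (s : seq 'cV[R]_k) (z : 'cV[R]_k) :
  gauss_avgs s (fun z : borel_vec R k => f (mu + A *m (z : 'cV[R]_k) : 'cV[R]_p)) z =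
  gauss_avgs [seq A *m a | a <- s] f (mu + A *m z).
Proof.
elim: s z => //= a s IH z; apply: eq_integral => t _; rewrite IH.
by congr (gauss_avgs _ f _); rewrite mulmxDr addrA scalemxAr.
Qed.

Lemma measurable_affine {R : realType} {k p : nat} (A : 'M[R]_(p, k)) (mu : 'cV_p) :
  measurable_fun setT
    (fun z : borel_vec R k => mu + A *m (z : 'cV[R]_k) : borel_vec R p).
Proof.
apply: measurable_borel_vec => i.
rewrite (_ : (fun _ => _) = (fun z : borel_vec R k =>
    mu i 0 + \sum_j A i j * (z : 'cV[R]_k) j 0)); last by apply/funext => z; rewrite !mxE.
apply: measurable_funD => //; apply: measurable_sum => j.
by apply: measurable_funM => //; exact: measurable_coord.
Qed.

(** The list [s] consists of the columns of the factor [A] that witnesses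
    normality. *)
Lemma is_mvnormal_gauss_avgs {R : realType} {p : nat}
    (Q : set (borel_vec R p) -> \bar R) (mu : 'cV[R]_p) (Sigma : 'M[R]_p) :
  is_mvnormal Q mu Sigma -> exists2 s, outer_sum s = Sigma &
    forall B, measurable B -> Q B = gauss_avgs s (fun z => (\1_B z)%:E) mu.
Proof.
move=> [k [A [G [hG AA hQ]]]]; exists [seq A *m a | a <- basis_vecs].
  rewrite -AA /outer_sum /basis_vecs -map_comp big_map big_enum/=.
  rewrite -[X in _ = X *m _]mulmx1.
  rewrite (_ : 1%:M = \sum_(i < k) delta_mx i 0 *m (delta_mx i (0 : 'I_1))^T).
    rewrite mulmx_sumr mulmx_suml; apply: eq_bigr => i _.
    by rewrite trmx_mul !mulmxA.
  rewrite [LHS]mx1_sum_delta; apply: eq_bigr => i _.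
  by rewrite trmx_delta mul_delta_mx.
move=> B mB; rewrite hQ// (std_normal_vecE hG); last first.
  by have := measurable_affine A mu measurableT mB; rewrite setTI.
rewrite /gauss_law -[mu in RHS]addr0 -[X in mu + X](mulmx0 _ A).
rewrite -(gauss_avgs_affine A mu (fun z => (\1_B z)%:E)).
by congr gauss_avgs.
Qed.

Lemma is_mvnormal_unique {R : realType} {p : nat}
    (Q1 Q2 : set (borel_vec R p) -> \bar R) (mu : 'cV[R]_p) (Sigma : 'M[R]_p) :
  is_mvnormal Q1 mu Sigma -> is_mvnormal Q2 mu Sigma ->
  forall B, measurable B -> Q1 B = Q2 B.
Proof.
move=> /is_mvnormal_gauss_avgs[s1 S1 Q1E] /is_mvnormal_gauss_avgs[s2 S2 Q2E] B mB.
rewrite Q1E// Q2E// (gauss_avgs_outer_sum (s2 := s2))//; last by rewrite S1.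
exact: indic_nneg_mfun.
Qed.

Lemma is_mvnormal_affine {R : realType} {n p : nat}
    (Q : set (borel_vec R n) -> \bar R) (mu : 'cV[R]_n) (Sigma : 'M[R]_n)
    (K : 'M[R]_(p, n)) (c : 'cV[R]_p) :
  is_mvnormal Q mu Sigma ->
  is_mvnormal (fun B => Q [set e : 'cV[R]_n | B (c + K *m e)])
    (c + K *m mu) (K *m Sigma *m K^T).
Proof.
move=> [k [A [G [hG AA hQ]]]]; exists k, (K *m A), G; split=> //.
  by rewrite trmx_mul -AA !mulmxA.
move=> B mB; rewrite hQ.
  by congr (G _); apply/seteqP; split=> z /=; rewrite mulmxDr addrA mulmxA.
by have := measurable_affine K c measurableT mB; rewrite setTI.
Qed.

(** * Optimality conditions of the Lasso *)

(** How a first-order condition follows from minimality: a step of length [r]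
    lowers the objective by [2 * (r * a)] and raises it by at most
    [2 * (r * c)], up to a term of order [r ^+ 2]. *)
Lemma first_order_le (R : realFieldType) (a c q : R) : 0 <= q ->
  (forall r, 0 <= r <= 1 -> 2 * (r * a) <= r ^+ 2 * q + 2 * (r * c)) -> a <= c.
Proof.
move=> q0 step; rewrite leNgt; apply/negP => ca.
pose e := a - c; have e0 : 0 < e by rewrite subr_gt0.
have qe : 0 < q + e by rewrite ltr_wpDl.
(* the step e / (q + e) makes the quadratic term smaller than the linear gain *)
pose r := e / (q + e).
have r0 : 0 < r by rewrite divr_gt0.
have r1 : r <= 1 by rewrite ler_pdivrMr// mul1r lerDr.
have := step r; rewrite (ltW r0) r1 => /(_ isT).
have rqe : r * (q + e) = e by rewrite divfK// gt_eqF.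
have rq : r * q = e - r * e by rewrite -{1}rqe mulrDr addrK.
have aE : a = c + e by rewrite /e addrC subrK.
rewrite expr2 -mulrA rq aE => H; clearbody e r.
have : 0 < r * e * (1 + r) by rewrite !mulr_gt0//; lra.
lra.
Qed.

Section lasso.
Context {R : realType} {n p : nat}.
Variables (X : 'M[R]_(n, p)) (lambda : 'rV[R]_p).
Implicit Types (y : 'cV[R]_n) (b c h : 'cV[R]_p).

Definition vdot k (u v : 'cV[R]_k) : R := \sum_(i < k) u i 0 * v i 0.

Lemma vdotDl k (u v w : 'cV[R]_k) : vdot (u + v) w = vdot u w + vdot v w.
Proof. by rewrite -big_split; apply: eq_bigr => i _; rewrite mxE mulrDl. Qed.

Lemma vdotNl k (u v : 'cV[R]_k) : vdot (- u) v = - vdot u v.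
Proof. by rewrite -sumrN; apply: eq_bigr => i _; rewrite mxE mulNr. Qed.

Lemma vdotNr k (u v : 'cV[R]_k) : vdot u (- v) = - vdot u v.
Proof. by rewrite -sumrN; apply: eq_bigr => i _; rewrite mxE mulrN. Qed.

Lemma vdotZr k (t : R) (u v : 'cV[R]_k) : vdot u (t *: v) = t * vdot u v.
Proof. by rewrite mulr_sumr; apply: eq_bigr => i _; rewrite mxE mulrCA. Qed.

Lemma vdot_trmx k l (A : 'M[R]_(k, l)) (u : 'cV[R]_k) (v : 'cV[R]_l) :
  vdot (A^T *m u) v = vdot u (A *m v).
Proof.
rewrite /vdot; under eq_bigr do rewrite mxE mulr_suml.
rewrite exchange_big; apply: eq_bigr => i _ /=; rewrite mxE mulr_sumr.
by apply: eq_bigr => j _; rewrite mxE; ring.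
Qed.

Lemma sqnormE k (u : 'cV[R]_k) : sqnorm u = vdot u u.
Proof. by apply: eq_bigr => i _; rewrite expr2. Qed.

Lemma sqnorm_ge0 k (u : 'cV[R]_k) : 0 <= sqnorm u.
Proof. by apply: sumr_ge0 => i _; exact: sqr_ge0. Qed.

Lemma sqnormB k (u v : 'cV[R]_k) :
  sqnorm (u - v) = sqnorm u - 2 * vdot u v + sqnorm v.
Proof.
rewrite /sqnorm /vdot mulr_sumr -sumrB -big_split; apply: eq_bigr => i _ /=.
by rewrite !mxE; ring.
Qed.

Lemma sqnormZ k (t : R) (u : 'cV[R]_k) : sqnorm (t *: u) = t ^+ 2 * sqnorm u.
Proof. by rewrite mulr_sumr; apply: eq_bigr => i _; rewrite mxE exprMn. Qed.

Lemma coord_le_sqnorm k (u : 'cV[R]_k) i : u i 0 ^+ 2 <= sqnorm u.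
Proof.
by rewrite /sqnorm (bigD1 i)//= lerDl; apply: sumr_ge0 => j _; exact: sqr_ge0.
Qed.

(** Minus one half of the gradient of the residual sum of squares. *)
Definition score y b : 'cV[R]_p := X^T *m (y - X *m b).

Definition penalty b : R := \sum_(j < p) lambda 0 j * `|b j 0|.

Lemma lasso_objective_step y b h :
  lasso_objective X lambda y (b + h) = lasso_objective X lambda y b
    - 2 * vdot (score y b) h + sqnorm (X *m h) + 2 * (penalty (b + h) - penalty b).
Proof.
rewrite /lasso_objective -!/(penalty _) mulmxDr opprD addrA sqnormB vdot_trmx.
ring.
Qed.

Hypothesis lambda_ge0 : forall j, 0 <= lambda 0 j.

(** The objective is convex and its non-smooth part is a sum over the coordinates,
    so minimality can be tested along the axes.  Letting [t] vary recovers the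
    usual conditions: the score is [lambda_j] times the sign of [b_j], or at most
    [lambda_j] in absolute value when [b_j = 0]. *)
Lemma lasso_minP y b :
  (forall b', lasso_objective X lambda y b <= lasso_objective X lambda y b') <->
  (forall (j : 'I_p) (t : R),
     score y b j 0 * t <= lambda 0 j * (`|b j 0 + t| - `|b j 0|)).
Proof.
split=> [bmin j t|bmin b'].
  set D := lambda 0 j * _; pose q := sqnorm (X *m delta_mx j (0 : 'I_1)) * t ^+ 2.
  have q0 : 0 <= q by rewrite mulr_ge0 ?sqnorm_ge0 ?sqr_ge0.
  have step r : 0 <= r <= 1 -> 2 * (r * (score y b j 0 * t)) <= r ^+ 2 * q + 2 * (r * D).
    move=> /andP[r0 r1].
    have := bmin (b + (r * t) *: delta_mx j 0); rewrite lasso_objective_step.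
    rewrite vdotZr -scalemxAr sqnormZ.
    have -> : vdot (score y b) (delta_mx j 0) = score y b j 0.
      rewrite /vdot (bigD1 j)//= [X in _ * X]mxE !eqxx mulr1 big1 ?addr0// => i ij.
      by rewrite [X in _ * X]mxE (negbTE ij) mulr0.
    have : penalty (b + (r * t) *: delta_mx j 0) - penalty b <= r * D.
      rewrite /penalty -sumrB (bigD1 j)//= big1 ?addr0; last first.
        by move=> i ij; rewrite !mxE (negbTE ij) mulr0 addr0 subrr.
      rewrite !mxE !eqxx mulr1 -mulrBr /D mulrCA ler_wpM2l//.
      have -> : b j 0 + r * t = (1 - r) * b j 0 + r * (b j 0 + t) by ring.
      have := ler_normD ((1 - r) * b j 0) (r * (b j 0 + t)).
      rewrite !normrM (ger0_norm r0) (@ger0_norm _ (1 - r)) ?subr_ge0//.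
      by move=> H; lra.
    rewrite /q exprMn; set pd := penalty _ - _; nra.
  exact: first_order_le q0 step.
rewrite -[b'](addrNK b) [b' - b + b]addrC; set h := b' - b.
rewrite lasso_objective_step.
suff : vdot (score y b) h <= penalty (b + h) - penalty b.
  have := sqnorm_ge0 (X *m h); move: (lasso_objective _ _ _ _) (sqnorm _).
  by move: (vdot _ _) (penalty (b + h)) => v w o q; lra.
rewrite /penalty -sumrB; apply: ler_sum => j _.
by rewrite -mulrBr [in leRHS]mxE; exact: bmin.
Qed.

(** Adding the first-order inequalities of [b1] towards [b2] and of [b2] towards
    [b1] cancels the penalties. *)
Lemma lasso_contraction y1 y2 b1 b2 :
  (forall b', lasso_objective X lambda y1 b1 <= lasso_objective X lambda y1 b') ->
  (forall b', lasso_objective X lambda y2 b2 <= lasso_objective X lambda y2 b') ->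
  sqnorm (X *m (b1 - b2)) <= sqnorm (y1 - y2).
Proof.
move=> /lasso_minP m1 /lasso_minP m2.
have var y b c : (forall (j : 'I_p) (t : R),
     score y b j 0 * t <= lambda 0 j * (`|b j 0 + t| - `|b j 0|)) ->
    vdot (score y b) (c - b) <= penalty c - penalty b.
  move=> m; rewrite /penalty -sumrB; apply: ler_sum => j _.
  have bc : b j 0 + (c - b) j 0 = c j 0 by rewrite !mxE; ring.
  by have := m j ((c - b) j 0); rewrite bc mulrBr.
have := lerD (var _ _ b2 m1) (var _ _ b1 m2).
set h := b1 - b2; rewrite -[b2 - b1]opprB -/h vdotNr; set v := X *m h.
have vE : vdot (score y2 b2) h - vdot (score y1 b1) h = sqnorm v - vdot (y1 - y2) v.
  have -> : sqnorm v - vdot (y1 - y2) v = vdot (X^T *m (v - (y1 - y2))) h.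
    by rewrite sqnormE -vdotNl -vdotDl vdot_trmx.
  rewrite -vdotNl -vdotDl /score -mulmxBr; congr (vdot (_ *m _) _).
  by rewrite /v /h mulmxBr; apply/matrixP => k l; rewrite !mxE; ring.
have := sqnorm_ge0 (y1 - y2 - v); rewrite (sqnormB _ v).
by move: vE; move: (sqnorm v) (sqnorm _) (vdot _ v) => q q' w; lra.
Qed.

Lemma trmx_mul_unit : \rank X = p -> X^T *m X \in unitmx.
Proof.
move=> rX; rewrite -row_free_unit; apply: inj_row_free => v vX.
have : sqnorm (X *m v^T) = 0.
  rewrite sqnormE -vdot_trmx mulmxA (_ : _ *m v^T = 0) ?/vdot ?big1//.
    by move=> i _; rewrite mxE mul0r.
  by apply: trmx_inj; rewrite !trmx_mul !trmxK vX trmx0.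
move=> Xv0; have Xv : X *m v^T = 0.
  apply/matrixP => i j; rewrite (ord1 j) [RHS]mxE; apply/eqP.
  by rewrite -sqrf_eq0 eq_le sqr_ge0 andbT -Xv0; exact: coord_le_sqnorm.
have /row_freeP[B XB] : row_free X^T by rewrite /row_free mxrank_tr rX.
by rewrite -[v]mulmx1 -XB mulmxA -[v *m _]trmxK trmx_mul trmxK Xv trmx0 mul0mx.
Qed.

(** Continuity is what makes the events about the Lasso measurable. *)
Lemma lasso_continuous (betaL : 'cV[R]_n -> 'cV[R]_p) (i : 'I_p) :
  \rank X = p -> is_lasso X lambda betaL -> continuous (fun y => betaL y i 0).
Proof.
move=> rX hbetaL.
have bmin y b' : lasso_objective X lambda y (betaL y) <= lasso_objective X lambda y b'.
  have : [set betaL y] (betaL y) by []. by rewrite -hbetaL; exact.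
pose L := invmx (X^T *m X) *m X^T; pose K := \sum_(l < n) `|L i l|.
have K0 : 0 <= K by apply: sumr_ge0.
move=> y1 A /= /(nbhs_ballP (betaL y1 i 0)) [e /= e0 eA].
pose r := e / (K * n%:R + 1).
have Kn0 : 0 <= K * n%:R by rewrite mulr_ge0.
have r0 : 0 < r by rewrite divr_gt0// ltr_wpDl.
have Kre : K * n%:R * r < e.
  by rewrite /r mulrCA gtr_pMr// ltr_pdivrMr ?mul1r ?ltrDl// ltr_wpDl.
clearbody r; apply/nbhs_ballP; exists r => //= y2 [_ y12B]; apply: eA.
set h := betaL y1 - betaL y2; rewrite /ball/=.
have -> : betaL y1 i 0 - betaL y2 i 0 = h i 0 by rewrite !mxE.
have -> : h = L *m (X *m h).
  by rewrite mulmxA /L -[_ *m _ *m X]mulmxA mulVmx ?mul1mx// trmx_mul_unit.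
have y12 l : `|(y1 - y2) l 0| <= r.
  by have := y12B l 0; rewrite /ball/= !mxE => /ltW.
have dy : sqnorm (y1 - y2) <= n%:R * r ^+ 2.
  rewrite -[n in n%:R]card_ord mulr_natl -sumr_const; apply: ler_sum => l _.
  by rewrite -[leLHS]real_normK ?num_real// ler_sqr ?nnegrE ?(ltW r0).
have Xh l : `|(X *m h) l 0| <= n%:R * r.
  have n1 : 1 <= n%:R :> R by rewrite ler1n (leq_trans _ (ltn_ord l)).
  rewrite -ler_sqr ?nnegrE ?mulr_ge0 ?(ltW r0)//.
  rewrite real_normK ?num_real// exprMn.
  apply: (le_trans (coord_le_sqnorm _ _)).
  apply: (le_trans (lasso_contraction (bmin y1) (bmin y2))).
  apply: (le_trans dy); rewrite ler_wpM2r ?sqr_ge0//.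
  by rewrite expr2 ler_peMr// (le_trans _ n1).
rewrite mxE (le_lt_trans (ler_norm_sum _ _ _))//.
apply: le_lt_trans Kre; rewrite -mulrA mulr_suml; apply: ler_sum => l _.
by rewrite normrM ler_wpM2l.
Qed.

End lasso.

(** * The scaled estimation error *)

Section scaled_error.
Context {R : realType} {n p : nat}.
Variables (X : 'M[R]_(n, p)) (lambda : 'rV[R]_p) (betaL : 'cV[R]_n -> 'cV[R]_p).
Hypotheses (n_gt0 : (0 < n)%N) (rankX : \rank X = p).
Hypothesis lambda_ge0 : forall j, 0 <= lambda 0 j.
Hypothesis betaL_lasso : is_lasso X lambda betaL.
Implicit Types (beta : 'cV[R]_p) (e : 'cV[R]_n).
Local Notation C := (gram X).
Local Notation rootn := (Num.sqrt n%:R : R).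

Definition scaled_error beta e : 'cV[R]_p :=
  rootn *: (betaL (X *m beta + e) - beta).

(** The minimizer once [|b_j|] is replaced by [d_j b_j] in the penalty, scaled as
    in [scaled_error]: the system of normal equations is then linear. *)
Definition signed_error (d : signs p) e : 'cV[R]_p :=
  - (rootn^-1 *: (invmx C *m diag_mx lambda *m sign_vec R d))
  + (rootn^-1 *: (invmx C *m X^T)) *m e.

Let rootn_gt0 : 0 < rootn.
Proof. by rewrite sqrtr_gt0 ltr0n. Qed.

Let rootn_neq0 : rootn != 0.
Proof. by rewrite gt_eqF. Qed.

Let natn_neq0 : n%:R != 0 :> R.
Proof. by rewrite pnatr_eq0 -lt0n. Qed.

Let rootn2 : rootn * rootn = n%:R.
Proof. by rewrite -expr2 sqr_sqrtr// ler0n. Qed.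

Lemma gram_unit : C \in unitmx.
Proof. by rewrite unitmxZ ?trmx_mul_unit// unitfE invr_eq0. Qed.

Lemma shift_setE (a beta : 'cV[R]_p) (M : set 'cV[R]_p) :
  shift_set a rootn^-1 M beta <-> M (rootn *: (a - beta)).
Proof.
split=> [[m Mm <-]|Mm].
  by rewrite opprB addrCA subrr addr0 scalerA divff// scale1r.
by exists (rootn *: (a - beta)) => //; rewrite scalerA mulVf// scale1r subKr.
Qed.

Lemma betaL_min y b' :
  lasso_objective X lambda y (betaL y) <= lasso_objective X lambda y b'.
Proof. have : [set betaL y] (betaL y) by []. by rewrite -betaL_lasso; exact. Qed.

Lemma gram_scaled_error beta e :
  C *m scaled_error beta e =
  rootn^-1 *: (X^T *m e - score X (X *m beta + e) (betaL (X *m beta + e))).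
Proof.
rewrite /scaled_error /gram /score; set b := betaL _.
rewrite -scalemxAr -scalemxAl scalerA -{2}rootn2 invfM mulrA divff// mul1r.
by congr (_ *: _); rewrite -mulmxBr -mulmxA; congr (_ *m _);
  rewrite mulmxBr; apply/matrixP => i j; rewrite !mxE; ring.
Qed.

Lemma gram_signed_error d e :
  C *m signed_error d e = rootn^-1 *: (X^T *m e - diag_mx lambda *m sign_vec R d).
Proof.
rewrite /signed_error mulmxDr mulmxN -scalemxAr -scalemxAl -scalemxAr !mulmxA.
by rewrite mulmxV ?gram_unit// !mul1mx -scalerN -scalerDr addrC.
Qed.

Lemma diag_sign_coord (d : signs p) (j : 'I_p) :
  (diag_mx lambda *m sign_vec R d) j 0 = lambda 0 j * (-1) ^+ d j.
Proof. by rewrite mul_diag_mx !mxE. Qed.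

Lemma sign_mul_le_norm (b : bool) (t : R) : (-1) ^+ b * t <= `|t|.
Proof. by rewrite -[`|t|](normrMsign b) ler_norm. Qed.

(** The pattern [d] is that of the signs of [beta], with [1] for a zero coordinate.
    It is the same for all [e]: this is why a single Gaussian law bounds the
    coverage at [beta]. *)
Lemma signed_error_sub (M : set 'cV[R]_p) beta : conditionA C M ->
  exists d, forall e, M (signed_error d e) -> M (scaled_error beta e).
Proof.
move=> cA; exists [ffun j => beta j 0 < 0] => e; set d : signs p := finfun _.
set u := scaled_error beta e; set b := betaL (X *m beta + e).
pose s j : R := (-1) ^+ d j.
have ss j : s j * s j = 1 by rewrite -expr2 sqrr_sign.
have ns j : `|s j| = 1 by exact: normr_sign.
have sb j : 0 <= s j * beta j 0.
  rewrite /s ffunE; case: ltP => bj; rewrite /= ?expr1 ?expr0.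
    by rewrite mulN1r oppr_ge0 ltW.
  by rewrite mul1r.
set g := score X (X *m beta + e) b.
have kkt := (lasso_minP X lambda_ge0 _ _).1 (betaL_min (X *m beta + e)).
have g_le j : s j * g j 0 <= lambda 0 j.
  rewrite mulrC (le_trans (kkt j (s j)))// ler_piMr// lerBlDl.
  by rewrite (le_trans (ler_normD _ _))// ns.
have g_eq j : 0 < s j * u j 0 -> s j * g j 0 = lambda 0 j.
  move=> su; apply/eqP; rewrite eq_le g_le/=.
  have bE : b j 0 = beta j 0 + rootn^-1 * u j 0.
    by rewrite !mxE mulrA mulVf// mul1r; ring.
  have sbj : 0 < s j * b j 0.
    by rewrite bE mulrDr ltr_wpDl// mulrCA mulr_gt0// invr_gt0.
  have bn : `|b j 0| = s j * b j 0.
    by rewrite -[LHS]mul1r -(ns j) -normrM gtr0_norm.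
  have := kkt j (- b j 0); rewrite subrr normr0 sub0r bn -/g mulrN mulrN lerN2.
  have -> : g j 0 * b j 0 = s j * g j 0 * (s j * b j 0).
    by rewrite mulrACA ss mul1r.
  by rewrite ler_pM2r.
(* the pattern for condition A depends on e, unlike d *)
move=> Mu; pose d' : signs p := [ffun j => if 0 < s j * u j 0 then ~~ d j else d j].
apply: (cA d' _ Mu) => j _ /=.
rewrite gram_signed_error gram_scaled_error -/b -/g -/u.
have -> : sign_vec R d' j 0 = if 0 < s j * u j 0 then - s j else s j.
  by rewrite mxE ffunE; case: ifP => // _; rewrite /s signrN.
have -> : (rootn^-1 *: (X^T *m e - diag_mx lambda *m sign_vec R d)) j 0 =
    rootn^-1 * ((X^T *m e) j 0 - lambda 0 j * s j).
  by rewrite -diag_sign_coord [LHS]mxE [X in _ * X]mxE [X in _ + X]mxE.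
have -> : (rootn^-1 *: (X^T *m e - g)) j 0 = rootn^-1 * ((X^T *m e) j 0 - g j 0).
  by rewrite [LHS]mxE [X in _ * X]mxE [X in _ + X]mxE.
case: ltP => su; split=> //.
- by rewrite -(g_eq j su) [s j * g j 0]mulrC -mulrA ss mulr1.
- by rewrite mulNr oppr_le0 ltW.
- rewrite !mulrA ![s j * _]mulrC -!mulrA ler_wpM2l ?invr_ge0 ?(ltW rootn_gt0)//.
  by rewrite !mulrBr lerD2l lerN2 [leRHS]mulrC -mulrA ss mulr1.
Qed.

(** If the linearized minimizer has the signs [d], it minimizes the true objective,
    whose minimizer is unique. *)
Lemma scaled_error_eq (d : signs p) beta e :
  (forall j, 0 <= (-1) ^+ d j * (beta j 0 + rootn^-1 * signed_error d e j 0)) ->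
  scaled_error beta e = signed_error d e.
Proof.
move=> h; set u := signed_error d e; pose b := beta + rootn^-1 *: u.
have bj j : b j 0 = beta j 0 + rootn^-1 * u j 0 by rewrite !mxE.
have scoreE : score X (X *m beta + e) b = diag_mx lambda *m sign_vec R d.
  have := gram_signed_error d e; rewrite -/u => Cu.
  have -> : score X (X *m beta + e) b = X^T *m e - X^T *m X *m (rootn^-1 *: u).
    rewrite /score -mulmxA -mulmxBr; congr (_ *m _); rewrite /b mulmxDr.
    by apply/matrixP => i j; rewrite !mxE; ring.
  have -> : X^T *m X = n%:R *: C by rewrite /gram scalerA divff// scale1r.
  rewrite -scalemxAl -scalemxAr Cu !scalerA.
  have -> : n%:R * rootn^-1 * rootn^-1 = 1 by rewrite -mulrA -invfM rootn2 divff.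
  by rewrite scale1r opprB addrCA subrr addr0.
have bmin : forall b', lasso_objective X lambda (X *m beta + e) b <=
                       lasso_objective X lambda (X *m beta + e) b'.
  apply/(lasso_minP X lambda_ge0) => j t.
  rewrite scoreE diag_sign_coord -mulrA ler_wpM2l// lerBrDr.
  have -> : `|b j 0| = (-1) ^+ d j * b j 0.
    by rewrite -[LHS](normrMsign (d j)) ger0_norm// bj.
  by rewrite -mulrDr addrC sign_mul_le_norm.
have -> : scaled_error beta e = rootn *: (b - beta).
  congr (_ *: (_ - _)).
  by have : [set betaL (X *m beta + e)] b by rewrite -betaL_lasso.
by rewrite /b addrC addKr scalerA divff// scale1r.
Qed.

End scaled_error.

(** * Coverage probabilities *)

Section coverage.
Context {R : realType} {n p : nat}.
Variables (X : 'M[R]_(n, p)) (lambda : 'rV[R]_p) (betaL : 'cV[R]_n -> 'cV[R]_p).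
Hypotheses (n_gt0 : (0 < n)%N) (rankX : \rank X = p).
Hypothesis lambda_ge0 : forall j, 0 <= lambda 0 j.
Hypothesis betaL_lasso : is_lasso X lambda betaL.
Context (d : measure_display) (Omega : measurableType d) (P : probability Omega R).
Variable eps : {RV P >-> borel_vec R n}.
Implicit Types (beta : 'cV[R]_p) (s : signs p) (M : set (borel_vec R p)).
Local Notation C := (gram X).
Local Notation rootn := (Num.sqrt n%:R : R).

Lemma measurable_event (f : borel_vec R n -> borel_vec R p) M :
  measurable_fun setT f -> measurable M -> measurable [set w | M (f (eps w))].
Proof.
move=> mf mM; have mfe : measurable_fun setT (f \o eps) by exact: measurableT_comp.
by have := mfe measurableT _ mM; rewrite setTI.
Qed.

Lemma measurable_scaled_error beta :
  measurable_fun setT (scaled_error X betaL beta : borel_vec R n -> borel_vec R p).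
Proof.
have mb : measurable_fun setT (betaL : borel_vec R n -> borel_vec R p).
  apply: measurable_borel_vec => i.
  apply: (@continuous_measurable_vec _ _ (fun y => betaL y i 0)).
  exact: (lasso_continuous lambda_ge0 rankX betaL_lasso).
have mX : measurable_fun setT
    (fun e : borel_vec R n => X *m beta + (e : 'cV[R]_n) : borel_vec R n).
  by have := measurable_affine (1%:M : 'M[R]_n) (X *m beta); under eq_fun do rewrite mul1mx.
have := measurableT_comp (measurable_affine (rootn%:M : 'M[R]_p) (- (rootn *: beta)))
  (measurableT_comp mb mX).
apply: eq_measurable_fun => e _ /=.
by rewrite /scaled_error mul_scalar_mx scalerBr addrC.
Qed.

Lemma measurable_signed_error s :
  measurable_fun setT (signed_error X lambda s : borel_vec R n -> borel_vec R p).
Proof. exact: measurable_affine. Qed.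

Lemma signed_error_mvnormal (sigma : R) s :
  is_mvnormal (distribution P eps) 0 ((sigma ^+ 2)%:M) ->
  is_mvnormal (fun B => P [set w | B (signed_error X lambda s (eps w))])
    (- (rootn^-1 *: (invmx C *m diag_mx lambda *m sign_vec R s)))
    (sigma ^+ 2 *: invmx C).
Proof.
move=> /(is_mvnormal_affine (rootn^-1 *: (invmx C *m X^T))
  (- (rootn^-1 *: (invmx C *m diag_mx lambda *m sign_vec R s)))).
rewrite mulmx0 addr0; set S := (X in is_mvnormal _ _ X -> _) => H.
suff <- : S = sigma ^+ 2 *: invmx C by exact: H.
have n0 : n%:R != 0 :> R by rewrite pnatr_eq0 -lt0n.
have CT : (invmx C)^T = invmx C.
  by rewrite trmx_inv /gram [(_ *: _)^T]linearZ/= trmx_mul trmxK.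
rewrite /S mul_mx_scalar -scalemxAl; congr (_ *: _).
have KT : (rootn^-1 *: (invmx C *m X^T))^T = rootn^-1 *: (X *m invmx C).
  by rewrite [LHS]linearZ/= trmx_mul trmxK CT.
have XX : X^T *m X = n%:R *: C by rewrite /gram scalerA divff// scale1r.
rewrite KT -scalemxAl -scalemxAr scalerA -mulmxA (mulmxA X^T) XX.
rewrite -scalemxAl mulmxV ?gram_unit// -scalemxAr mulmx1 scalerA.
by rewrite -invfM -expr2 sqr_sqrtr ?ler0n// mulVf// scale1r.
Qed.

Lemma coverage_ge M beta : measurable M -> conditionA C M ->
  exists s, (P [set w | M (signed_error X lambda s (eps w))] <=
             P [set w | M (scaled_error X betaL beta (eps w))])%E.
Proof.
move=> mM cA; have [s sub] :=
  signed_error_sub n_gt0 rankX lambda_ge0 betaL_lasso beta cA.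
exists s; apply: le_measure; rewrite ?inE.
- exact: measurable_event (measurable_signed_error s) mM.
- exact: measurable_event (measurable_scaled_error beta) mM.
- by move=> w; exact: sub.
Qed.

(** Along the parameters [k%:R *: sign_vec R s] the probability that the two errors
    differ tends to [0]. *)
Lemma coverage_far M s : measurable M ->
  (ereal_inf [set P [set w | M (scaled_error X betaL beta (eps w))] | beta in [set: 'cV[R]_p]]
   <= P [set w | M (signed_error X lambda s (eps w))])%E.
Proof.
move=> mM; set E := [set w | M (signed_error _ _ _ _)].
pose u w : 'cV[R]_p := signed_error X lambda s (eps w).
have mu : measurable_fun setT (u : Omega -> borel_vec R p).
  by apply: measurableT_comp => //; exact: measurable_signed_error.
pose g (j : 'I_p) w : R := (-1) ^+ s j * (rootn^-1 * u w j 0).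
have mg j : measurable_fun setT (g j).
  apply: measurable_funM => //; apply: measurable_funM => //.
  exact: measurableT_comp (measurable_coord j) mu.
(* for k%:R *: sign_vec R s, the linearized minimizer fails to have the signs s *)
pose N k := \bigcup_(j in [set: 'I_p]) (g j @^-1` `]-oo, - k%:R[%classic).
have mN k : measurable (N k).
  apply: fin_bigcup_measurable => // j _.
  by rewrite -[X in measurable X]setTI; exact: mg.
have mE : measurable E by exact: measurable_event (measurable_signed_error s) mM.
have N0 : \bigcap_k N k = set0.
  rewrite -subset0 => w Nw.
  (* beyond this k, no coordinate of w can be exceptional *)
  have [j _] := Nw (Num.bound (\sum_j `|g j w|)) I.
  rewrite /= in_itv/= ltNge => /negP; apply.
  rewrite lerNl (le_trans (ler_norm _))// normrN.
  apply: (@le_trans _ _ (\sum_j `|g j w|)); last first.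
    by rewrite ltW// archi_boundP// sumr_ge0.
  by rewrite (bigD1 j)//= lerDl sumr_ge0.
have Ncvg : P \o N @ \oo --> 0%E.
  rewrite -(measure0 P) -N0; apply: nonincreasing_cvg_mu => //.
  - by rewrite (le_lt_trans (probability_le1 _ _))// ltry.
  - by rewrite N0.
  - move=> k l kl; apply/subsetPset => w [j _ /=]; rewrite in_itv/= => gj.
    by exists j => //=; rewrite in_itv/= (lt_le_trans gj)// lerN2 ler_nat.
have bound k : (ereal_inf [set P [set w | M (scaled_error X betaL beta (eps w))]
    | beta in [set: 'cV[R]_p]] <= P E + P (N k))%E.
  pose beta : 'cV[R]_p := k%:R *: sign_vec R s.
  apply: (@le_trans _ _ (P [set w | M (scaled_error X betaL beta (eps w))])).
    by apply: ereal_inf_lbound; exists beta.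
  apply: (le_trans _ (measureU2 _ mE (mN k))).
  apply: le_measure; rewrite ?inE.
  - exact: measurable_event (measurable_scaled_error beta) mM.
  - exact: measurableU.
  - move=> w /= Mw; have [Nw|Nw] := pselect (N k w); [by right|left].
    rewrite /E/=.
    rewrite -(scaled_error_eq n_gt0 rankX lambda_ge0 betaL_lasso (beta := beta))//.
    move=> j; rewrite [beta j 0]mxE [sign_vec _ _ _ _]mxE mulrDr mulrCA -expr2.
    rewrite sqrr_sign mulr1 addrC -lerBlDr sub0r leNgt; apply/negP => gk; apply: Nw.
    by exists j; rewrite //= in_itv.
have : (fun k => P E + P (N k))%E @ \oo --> (P E + 0)%E.
  by apply: cvgeD => //; [rewrite fin_num_adde_defl|exact: cvg_cst].
rewrite adde0 => /cvge_to_ge; apply.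
by apply: nearW.
Qed.

End coverage.

(** * The infimal coverage *)

Lemma rank_nrows_gt0 (F : fieldType) (n p : nat) (X : 'M[F]_(n, p)) :
  \rank X = p -> (0 < p)%N -> (0 < n)%N.
Proof. by move=> <- /leq_trans; apply; exact: rank_leq_row. Qed.

Theorem corollary2 (R : realType) (n p : nat) (X : 'M[R]_(n, p)) (sigma : R)
    (lambda : 'rV[R]_p)
    (dO : measure_display) (Omega : measurableType dO)
    (P : probability Omega R) (eps : {RV P >-> borel_vec R n})
    (betaL : 'cV[R]_n -> 'cV[R]_p)
    (dU : measure_display) (OmegaU : measurableType dU)
    (PU : probability OmegaU R) (uhat : signs p -> {RV PU >-> borel_vec R p})
    (alpha : R) (M : set (borel_vec R p))
    (hX : \rank X = p)
    (hsigma : 0 < sigma)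
    (heps : is_mvnormal (distribution P eps) 0 ((sigma ^+ 2)%:M))
    (hlambda : forall j : 'I_p, 0 <= lambda 0 j)
    (hbetaL : is_lasso X lambda betaL)
    (huhat : forall d : signs p,
      is_mvnormal (distribution PU (uhat d))
        (- ((Num.sqrt n%:R)^-1 *:
            (invmx (gram X) *m diag_mx lambda *m sign_vec R d)))
        (sigma ^+ 2 *: invmx (gram X)))
    (halpha : 0 < alpha < 1)
    (hM : measurable M)
    (hA : conditionA (gram X) M)
    (hmin : \big[Order.min/+oo%E]_(d : signs p) PU (uhat d @^-1` M) =
            (1 - alpha)%:E) :
  ereal_inf
    [set P [set w | shift_set (betaL (X *m beta + (eps w : 'cV[R]_n)))
                      (Num.sqrt n%:R)^-1 M beta]
       | beta in [set: 'cV[R]_p]] =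
  (1 - alpha)%:E.
Proof.
have [a0 a1] := andP halpha.
(* for p = 0 there is a single vector, so M has probability 0 or 1 *)
have p_gt0 : (0 < p)%N.
  rewrite lt0n; apply/eqP => p0; move: hmin.
  have vec_eq (u v : 'cV[R]_p) : u = v.
    by apply/matrixP => i; have := ltn_ord i; rewrite [X in (_ < X)%N]p0.
  have [M0|M0] := pselect (M (0 : 'cV[R]_p)).
    have MT : M = setT by apply/seteqP; split=> // x _; rewrite (vec_eq x 0).
    have : (1%:E <= \big[Order.min/+oo%E]_(d : signs p) PU (uhat d @^-1` M))%E.
      by apply: le_bigmin => [|d _]; rewrite ?leey// MT preimage_setT probability_setT.
    by move=> + E; rewrite E lee_fin; lra.
  have Me : M = set0 by apply/seteqP; split=> // x Mx; apply: M0; rewrite (vec_eq 0 x).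
  have : (\big[Order.min/+oo%E]_(d : signs p) PU (uhat d @^-1` M) <= 0%:E)%E.
    apply: (le_trans (bigmin_le _ ([ffun=> false] : signs p) _)).
    by rewrite Me preimage_set0 measure0.
  by move=> + E; rewrite E lee_fin; lra.
have n_gt0 : (0 < n)%N := rank_nrows_gt0 hX p_gt0.
have lawE d : P [set w | M (signed_error X lambda d (eps w))] = PU (uhat d @^-1` M).
  exact: (is_mvnormal_unique (signed_error_mvnormal lambda n_gt0 hX d heps) (huhat d) hM).
have -> : [set P [set w | shift_set (betaL (X *m beta + (eps w : 'cV[R]_n)))
                      (Num.sqrt n%:R)^-1 M beta] | beta in [set: 'cV[R]_p]] =
    [set P [set w | M (scaled_error X betaL beta (eps w))] | beta in [set: 'cV[R]_p]].
  apply: eq_imagel => beta _; congr (P _).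
  by apply/seteqP; split=> w /(shift_setE n_gt0).
apply/eqP; rewrite eq_le -hmin; apply/andP; split.
  apply: le_bigmin => [|d _]; first by rewrite leey.
  by rewrite -lawE; exact: (coverage_far n_gt0 hX hlambda hbetaL eps d hM).
apply: le_ereal_inf_tmp => _ [beta _ <-].
have [d] := coverage_ge n_gt0 hX hlambda hbetaL eps beta hM hA.
by apply: le_trans; rewrite lawE; exact: bigmin_le.
Qed.
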